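(* Let $Ag$ be a finite set of agents, $\mathcal{CS}$ a constant specification and $A\in Form^{Ag}$ with $\vdash_{\mathcal{CS}}A$. Then $A$ is valid over the class of $\mathcal{CS}$-normal jstit models, i.e. $\mathcal{M},m,h\models A$ for every $\mathcal{CS}$-normal jstit model $\mathcal{M}$ and every $(m,h)\in MH(\mathcal{M})$.
   Context: Language. Fix a finite set $Ag$ of agents, countably infinite sets $PVar$, $PConst$, $Var$. $Pol$: $t ::= x \mid c \mid s+t \mid s\times t \mid\ !t$. $Form^{Ag}$: $A ::= p \mid A\wedge B \mid \neg A \mid [j]A \mid \Box A \mid t{:}A \mid KA \mid Prove(j,t,A) \mid Proven(t,A)$; $\Diamond$, $\langle j\rangle$ are the duals, other connectives abbreviations. Jstit models: $\mathcal{M}=\langle Tree,\unlhd,Choice,Act,R,R_e,\mathcal{E},V\rangle$, $Tree\neq\emptyset$, $\unlhd$ a partial order, histories = maximal $\unlhd$-chains, $H_m$ = histories through $m$, $MH(\mathcal{M})=\{(m,h):h\in H_m\}$; $Choice^m_j$ a partition of $H_m$ for each $m$, $j$ (cell of $h$: $Choice^m_j(h)$); $Act:MH(\mathcal{M})\to 2^{Pol}$; $R\subseteq R_e$ preorders on $Tree$; $\mathcal{E}:Tree\times Pol\to 2^{Form^{Ag}}$; $V:Var\to 2^{MH(\mathcal{M})}$. $Act_m=\bigcap_{h\in H_m}Act(m,h)$, $Act_{(m,h,j)}=\bigcap_{g\in Choice^m_j(h)}Act(m,g)$, $h\approx_m g$ iff $h,g\in H_{m'}$ for some $m'\rhd m$.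 Constraints: (1) any two moments have a common $\unlhd$-lower bound; (2) no backward branching: $m_1,m_2\unlhd m$ implies they are comparable; (3) $h\approx_m h'$ implies $Choice^m_j(h)=Choice^m_j(h')$; (4) independence: any selection of one cell of $Choice^m_j$ for each $j$ has nonempty intersection; (5) $R_e(m,m')\Rightarrow\mathcal{E}(m,t)\subseteq\mathcal{E}(m',t)$; (6) $A\to B\in\mathcal{E}(m,s)$, $A\in\mathcal{E}(m,t)\Rightarrow B\in\mathcal{E}(m,s\times t)$; $\mathcal{E}(m,s)\cup\mathcal{E}(m,t)\subseteq\mathcal{E}(m,s+t)$; $A\in\mathcal{E}(m,t)\Rightarrow t{:}A\in\mathcal{E}(m,!t)$; (7) $m'\lhd m$, $h\in H_m\Rightarrow Act(m',h)\subseteq Act(m,h)$; (8) $Act_m\subseteq\bigcup_{m'\lhd m,h\in H_m}Act(m',h)$; (9) $h\approx_m h'\Rightarrow Act(m,h)=Act(m,h')$; (10) $\unlhd\subseteq R$; (11) $R_e(m,m')\Rightarrow Act_m\subseteq Act_{m'}$. Satisfaction: $p$ iff $(m,h)\in V(p)$; Booleans standard; $[j]A$: $A$ at all $(m,h')$, $h'\in Choice^m_j(h)$; $\Box A$: $A$ at all $(m,h')$, $h'\in H_m$; $KA$: $A$ at all $(m',h')$ with $R(m,m')$, $h'\in H_{m'}$; $t{:}A$: $A\in\mathcal{E}(m,t)$ and $A$ at all $(m',h')$ with $R_e(m,m')$, $h'\in H_{m'}$; $Prove(j,t,A)$: $t\in Act_{(m,h,j)}$, $t{:}A$ at $(m,h)$,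 $t\notin Act_m$; $Proven(t,A)$: $t\in Act_m$ and $t{:}A$ at $(m,h)$. System $\Pi$: axiom schemes (A0) propositional tautologies; (A1) S5 for $\Box$ and each $[j]$; (A2) $\Box A\to[j]A$; (A3) $(\Diamond[j_1]A_1\wedge\dots\wedge\Diamond[j_n]A_n)\to\Diamond([j_1]A_1\wedge\dots\wedge[j_n]A_n)$, $j_i$ pairwise distinct; (A4) $s{:}(A\to B)\to(t{:}A\to(s\times t){:}B)$; (A5) $t{:}A\to(!t{:}(t{:}A)\wedge KA)$; (A6) $(s{:}A\vee t{:}A)\to(s+t){:}A$; (A7) S4 for $K$; (A8) $KA\to\Box K\Box A$; (B9) $Prove(j,t,A)\to(\neg Proven(t,A)\wedge[j]Prove(j,t,A)\wedge\neg\Box Prove(j,t,A)\wedge t{:}A)$; (B10) $(Prove(j,t,A)\wedge t{:}B)\to Prove(j,t,B)$; (B11) $Proven(t,A)\to(KProven(t,A)\wedge t{:}A)$; (B12) $(Proven(t,A)\wedge t{:}B)\to Proven(t,B)$; (B13) $\neg Prove(j,t,A)\to\langle j\rangle\bigwedge_{i\in Ag}\neg Prove(i,t,A)$. Rules: modus ponens; from $A$ infer $KA$; (S4) from $KA\to(\neg Proven(t_1,B_1)\vee\dots\vee\neg Proven(t_n,B_n))$ infer $KA\to(\bigwedge_{j\in Ag}\neg Prove(j,t_1,B_1)\vee\dots\vee\bigwedge_{j\in Ag}\neg Prove(j,t_n,B_n))$. A constant specification $\mathcal{CS}$ is a set of formulas $c_n{:}\dots c_1{:}A$ ($c_i\in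 PConst$, $A$ an axiom instance) closed under removing the outermost constant; $\Pi(\mathcal{CS})$ adds the rule ''infer any member of $\mathcal{CS}$''; $\vdash_{\mathcal{CS}}$ denotes provability in $\Pi(\mathcal{CS})$. A jstit model is $\mathcal{CS}$-normal iff $\{A: c{:}A\in\mathcal{CS}\}\subseteq\mathcal{E}(m,c)$ for all $c$, $m$. *)

(* Defs.v *)
From Corelib Require Relation_Definitions.
From mathcomp Require Import all_boot classical_sets.

Set Implicit Arguments.
Unset Strict Implicit.
Unset Printing Implicit Defensive.

Local Open Scope classical_set_scope.

(* Three copies of nat serve as the fixed countably infinite alphabets; they
   are kept disjoint by the constructors [PolVar], [PolConst] and [Atom]. *)
Definition PVar := nat.
Definition PConst := nat.
Definition Var := nat.

Inductive pol : Type :=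
| PolVar of PVar
| PolConst of PConst
| PolSum of pol & pol
| PolApp of pol & pol
| PolBang of pol.

Inductive form (Ag : finType) : Type :=
| Atom of Var
| And of form Ag & form Ag
| Neg of form Ag
| Stit of Ag & form Ag
| Box of form Ag
| Just of pol & form Ag
| Know of form Ag
| Prove of Ag & pol & form Ag
| Proven of pol & form Ag.

Arguments Atom {Ag} _.

Declare Scope jstit_scope.
Delimit Scope jstit_scope with J.
Bind Scope jstit_scope with form.

Notation "A :/\: B" := (And A B)
  (at level 60, right associativity) : jstit_scope.
Notation ":~ A" := (Neg A) (at level 35, right associativity) : jstit_scope.

Definition Or Ag (A B : form Ag) : form Ag := (:~ (:~ A :/\: :~ B))%J.
Definition Imp Ag (A B : form Ag) : form Ag := (:~ (A :/\: :~ B))%J.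
Definition Diamond Ag (A : form Ag) : form Ag := (:~ Box (:~ A))%J.
Definition DStit (Ag : finType) (j : Ag) (A : form Ag) : form Ag := (:~ Stit j (:~ A))%J.

Notation "A :\/: B" := (Or A B)
  (at level 62, right associativity) : jstit_scope.
Notation "A :->: B" := (Imp A B)
  (at level 65, right associativity) : jstit_scope.

Local Open Scope jstit_scope.

(* Finite conjunctions and disjunctions associate to the right.  The empty
   cases can only arise for conjunctions over an empty [Ag]. *)
Definition Top Ag : form Ag := Atom 0 :->: Atom 0.

Fixpoint bigAnd Ag (s : seq (form Ag)) : form Ag :=
  match s with
  | [::] => Top Ag
  | [:: A] => A
  | A :: s' => A :/\: bigAnd s'
  end.

Fixpoint bigOr Ag (s : seq (form Ag)) : form Ag :=
  match s with
  | [::] => :~ Top Ag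
  | [:: A] => A
  | A :: s' => A :\/: bigOr s'
  end.

Definition noProver Ag (t : pol) (A : form Ag) : form Ag :=
  bigAnd [seq :~ Prove i t A | i <- enum Ag].

(* Every formula whose main connective is not Boolean is a propositional atom. *)
Fixpoint prop_eval Ag (v : form Ag -> bool) (A : form Ag) : bool :=
  match A with
  | And B C => prop_eval v B && prop_eval v C
  | Neg B => ~~ prop_eval v B
  | _ => v A
  end.

Definition tautology Ag (A : form Ag) : Prop :=
  forall v : form Ag -> bool, prop_eval v A.

Inductive S4_axiom Ag (M : form Ag -> form Ag) : form Ag -> Prop :=
| S4_K A B : S4_axiom M (M (A :->: B) :->: (M A :->: M B))
| S4_T A : S4_axiom M (M A :->: A)
| S4_4 A : S4_axiom M (M A :->: M (M A)).

(* The redundant 4, B and 5 are all included, so that constant specifications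
   written for any usual presentation of S5 are covered. *)
Inductive S5_axiom Ag (M : form Ag -> form Ag) : form Ag -> Prop :=
| S5_S4 A : S4_axiom M A -> S5_axiom M A
| S5_B A : S5_axiom M (A :->: M (:~ M (:~ A)))
| S5_5 A : S5_axiom M (:~ M A :->: M (:~ M A)).

Inductive axiom (Ag : finType) : form Ag -> Prop :=
| A0 A : tautology A -> axiom A
| A1_box A : S5_axiom (@Box Ag) A -> axiom A
| A1_stit j A : S5_axiom (@Stit Ag j) A -> axiom A
| A2 j A : axiom (Box A :->: Stit j A)
| A3 (s : seq (Ag * form Ag)) : s <> [::] -> uniq (unzip1 s) ->
    axiom (bigAnd [seq Diamond (Stit x.1 x.2) | x <- s]
           :->: Diamond (bigAnd [seq Stit x.1 x.2 | x <- s]))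
| A4 s t A B :
    axiom (Just s (A :->: B) :->: (Just t A :->: Just (PolApp s t) B))
| A5 t A : axiom (Just t A :->: (Just (PolBang t) (Just t A) :/\: Know A))
| A6 s t A : axiom ((Just s A :\/: Just t A) :->: Just (PolSum s t) A)
| A7 A : S4_axiom (@Know Ag) A -> axiom A
| A8 A : axiom (Know A :->: Box (Know (Box A)))
| B9 j t A :
    axiom (Prove j t A :->:
           (:~ Proven t A :/\: Stit j (Prove j t A)
            :/\: :~ Box (Prove j t A) :/\: Just t A))
| B10 j t A B : axiom ((Prove j t A :/\: Just t B) :->: Prove j t B)
| B11 t A : axiom (Proven t A :->: (Know (Proven t A) :/\: Just t A))
| B12 t A B : axiom ((Proven t A :/\: Just t B) :->: Proven t B)
| B13 j t A : axiom (:~ Prove j t A :->: DStit j (noProver t A)).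

(* [constPrefix [:: c_n; ..; c_1] A] is  c_n : ... : c_1 : A. *)
Definition constPrefix Ag (cs : seq PConst) (A : form Ag) : form Ag :=
  foldr (fun c B => Just (PolConst c) B) A cs.

Record constant_specification Ag (CS : set (form Ag)) : Prop := {
  cs_shape : forall F, CS F ->
    exists c cs A, axiom A /\ F = constPrefix (c :: cs) A;
  cs_closed : forall c c' cs A, axiom A ->
    CS (constPrefix (c :: c' :: cs) A) -> CS (constPrefix (c' :: cs) A)
}.

Inductive provable Ag (CS : set (form Ag)) : form Ag -> Prop :=
| Pr_axiom A : axiom A -> provable CS A
| Pr_CS A : CS A -> provable CS A
| Pr_MP A B : provable CS (A :->: B) -> provable CS A -> provable CS B
| Pr_Nec A : provable CS A -> provable CS (Know A)
| Pr_S4 A (s : seq (pol * form Ag)) : s <> [::] ->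
    provable CS (Know A :->: bigOr [seq :~ Proven x.1 x.2 | x <- s]) ->
    provable CS (Know A :->: bigOr [seq noProver x.1 x.2 | x <- s]).

(* [Act m h] is only meaningful for h a history through m; its values elsewhere
   are irrelevant. *)
Record jstit_data (Ag : finType) : Type := {
  Tree : Type;
  le : Tree -> Tree -> Prop;
  Choice : Tree -> Ag -> set (set (set Tree));
  Act : Tree -> set Tree -> set pol;
  R : Tree -> Tree -> Prop;
  Re : Tree -> Tree -> Prop;
  Evid : Tree -> pol -> set (form Ag);
  V : Var -> set (Tree * set Tree)
}.

Section Notions.
Variables (Ag : finType) (M : jstit_data Ag).
Implicit Types (m : Tree M) (h g : set (Tree M)) (j : Ag).

Definition lt m m' : Prop := le m m' /\ m <> m'.

Definition history h : Prop :=
  total_on h (@le _ M) /\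
  forall g, total_on g (@le _ M) -> h `<=` g -> g = h.

Definition H m : set (set (Tree M)) := [set h | history h /\ h m].

Definition MH : set (Tree M * set (Tree M)) := [set mh | H mh.1 mh.2].

Definition cell m j h : set (set (Tree M)) :=
  [set g | exists C, [/\ Choice m j C, C h & C g]].

Definition Act_m m : set pol := \bigcap_(h in H m) Act m h.

Definition Act_mhj m h j : set pol := \bigcap_(g in cell m j h) Act m g.

Definition undivided m h g : Prop := exists m', [/\ lt m m', H m' h & H m' g].

End Notions.

Record is_jstit (Ag : finType) (M : jstit_data Ag) : Prop := {
  Tree_nonempty : inhabited (Tree M);
  le_order : Relation_Definitions.order (Tree M) (@le _ M);
  Choice_partition : forall (m : Tree M) j, partition (Choice m j) id (H m);
  R_preorder : Relation_Definitions.preorder (Tree M) (@R _ M);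
  Re_preorder : Relation_Definitions.preorder (Tree M) (@Re _ M);
  R_sub_Re : forall m m' : Tree M, R m m' -> Re m m';
  V_MH : forall p, @V _ M p `<=` @MH _ M;
  historical_connection : forall m1 m2 : Tree M, exists m, le m m1 /\ le m m2;
  no_backward_branching : forall m m1 m2 : Tree M,
    le m1 m -> le m2 m -> le m1 m2 \/ le m2 m1;
  no_choice_between_undivided : forall (m : Tree M) j h h',
    undivided m h h' -> cell m j h = cell m j h';
  independence_of_agents : forall (m : Tree M) (f : Ag -> set (set (Tree M))),
    (forall j, Choice m j (f j)) -> \bigcap_(j in [set: Ag]) f j !=set0;
  Evid_mono : forall (m m' : Tree M) t, Re m m' -> Evid m t `<=` Evid m' t;
  Evid_app : forall (m : Tree M) s t A B,
    Evid m s (A :->: B) -> Evid m t A -> Evid m (PolApp s t) B;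
  Evid_sum : forall (m : Tree M) s t,
    Evid m s `|` Evid m t `<=` Evid m (PolSum s t);
  Evid_bang : forall (m : Tree M) t A,
    Evid m t A -> Evid m (PolBang t) (Just t A);
  Act_expansion : forall (m m' : Tree M) h,
    lt m' m -> H m h -> Act m' h `<=` Act m h;
  no_new_proofs_guaranteed : forall m : Tree M, Act_m m `<=`
    [set t | exists m' h, [/\ lt m' m, H m h & Act m' h t]];
  presenting_a_new_proof : forall (m : Tree M) h h',
    undivided m h h' -> Act m h = Act m h';
  future_matters : forall m m' : Tree M, le m m' -> R m m';
  proofs_transparent : forall m m' : Tree M,
    Re m m' -> Act_m m `<=` Act_m m'
}.

Record jstit_model (Ag : finType) : Type := {
  jstit_of :> jstit_data Ag;
  jstit_ofP : is_jstit jstit_of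
}.

Fixpoint sat (Ag : finType) (M : jstit_data Ag) (m : Tree M) (h : set (Tree M))
    (A : form Ag) : Prop :=
  match A with
  | Atom p => V p (m, h)
  | And B C => sat m h B /\ sat m h C
  | Neg B => ~ sat m h B
  | Stit j B => forall h', cell m j h h' -> sat m h' B
  | Box B => forall h', H m h' -> sat m h' B
  | Just t B =>
      Evid m t B /\ forall m' h', Re m m' -> H m' h' -> sat m' h' B
  | Know B => forall m' h', R m m' -> H m' h' -> sat m' h' B
  | Prove j t B =>
      [/\ Act_mhj m h j t,
          Evid m t B /\ (forall m' h', Re m m' -> H m' h' -> sat m' h' B)
        & ~ Act_m m t]
  | Proven t B =>
      Act_m m t /\
      (Evid m t B /\ forall m' h', Re m m' -> H m' h' -> sat m' h' B)
  end.

Definition CS_normal Ag (CS : set (form Ag)) (M : jstit_data Ag) : Prop :=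
  forall (c : PConst) (m : Tree M),
    [set A | CS (Just (PolConst c) A)] `<=` Evid m (PolConst c).

(* Main.v *)
From HB Require Import structures.
From mathcomp Require Import all_boot boolp classical_sets.
Require Import Defs.

(** Soundness, by induction on the derivation.  The rule (S4) is the delicate
    case.  Suppose that every t_i is proved by some agent at (m,h), so that
    each t_i lies in Act(m,h) but not in Act_m.  If h passes through some m'
    strictly above m, then every history through m' is undivided from h at m,
    so that each t_i lies in Act_m', hence is proven at m', where K A still
    holds: this contradicts the premise.  Otherwise m is the last moment of h,
    so h is the only history through m and Act_m = Act(m,h), a contradiction. *)

Set Implicit Arguments.
Unset Strict Implicit.
Unset Printing Implicit Defensive.

Local Open Scope classical_set_scope.
Local Open Scope jstit_scope.

(* Classical equality, for list membership. *)
HB.instance Definition _ := gen_eqMixin pol.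
HB.instance Definition _ (Ag : finType) := gen_eqMixin (form Ag).

(** * Semantic clauses of the defined connectives *)

Section Connectives.
Variables (Ag : finType) (M : jstit_data Ag) (m : Tree M) (h : set (Tree M)).

Lemma sat_Imp (A B : form Ag) : sat m h (A :->: B) <-> (sat m h A -> sat m h B).
Proof.
split=> [nAnB hA | AB [hA]]; last by apply; exact: AB.
by apply: contrapT => nB; apply: nAnB.
Qed.

Lemma sat_Or (A B : form Ag) : sat m h (A :\/: B) <-> sat m h A \/ sat m h B.
Proof.
split=> [nn | [hA [] | hB [_]]] //.
by apply: contrapT => /not_orP nAB; apply: nn.
Qed.

Lemma sat_Diamond (A : form Ag) :
  sat m h (Diamond A) <-> exists2 g, H m g & sat m g A.
Proof.
split=> [nall | [g Hg gA] nA]; last exact: nA Hg gA.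
by apply: contrapT => nex; apply: nall => g Hg gA; apply: nex; exists g.
Qed.

Lemma sat_DStit (j : Ag) (A : form Ag) :
  sat m h (DStit j A) <-> exists2 g, cell m j h g & sat m g A.
Proof.
split=> [nall | [g Hg gA] nA]; last exact: nA Hg gA.
by apply: contrapT => nex; apply: nall => g Hg gA; apply: nex; exists g.
Qed.

Lemma sat_Top : sat m h (Top Ag).
Proof. exact/sat_Imp. Qed.

Lemma sat_bigAnd (s : seq (form Ag)) :
  sat m h (bigAnd s) <-> forall A, A \in s -> sat m h A.
Proof.
elim: s => [|A s IH]; first by split=> // _; exact: sat_Top.
(* [bigAnd] returns a singleton without a trailing [Top]; since [Top] always holds, the uniform
   clause for a nonempty list covers that case too. *)
have -> : sat m h (bigAnd (A :: s)) <-> sat m h A /\ sat m h (bigAnd s).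
  by case: s {IH} => //; split=> [|[]//]; split=> //; exact: sat_Top.
rewrite IH; split=> [[hA hs] B|hs].
  by rewrite inE => /predU1P[->//|]; exact: hs.
by split=> [|B Bs]; apply: hs; rewrite inE ?eqxx ?Bs ?orbT.
Qed.

Lemma sat_bigOr (s : seq (form Ag)) :
  sat m h (bigOr s) <-> exists2 A, A \in s & sat m h A.
Proof.
elim: s => [|A s IH]; first by split=> [/(_ sat_Top)|[]].
have -> : sat m h (bigOr (A :: s)) <-> sat m h A \/ sat m h (bigOr s).
  case: s {IH} => [|B s]; last exact: sat_Or.
  by split=> [|[//|/(_ sat_Top)]]; first by left.
rewrite IH; split=> [[hA|[B Bs hB]]|[B]].
- by exists A; rewrite ?inE ?eqxx.
- by exists B; rewrite ?inE ?Bs ?orbT.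
by rewrite inE => /predU1P[->|Bs] hB; [left | right; exists B].
Qed.

(** Formulas without a Boolean main connective become atoms valued by their truth at the given
    point; a tautology is true under this valuation in particular. *)
Lemma sat_prop_eval (A : form Ag) :
  sat m h A <-> prop_eval (fun B => `[< sat m h B >]) A.
Proof.
elim: A => [p|B IHB C IHC|B IHB|j B _|B _|t B _|B _|j t B _|t B _] /=;
  try by split=> /asboolP.
- by rewrite IHB IHC; split=> /andP.
- by rewrite IHB; split=> /negP.
Qed.

End Connectives.

(** * Validity in a fixed model, and its choice cells *)

Section Validity.
Variables (Ag : finType) (M : jstit_model Ag).
Implicit Types (m : Tree M) (h g : set (Tree M)) (j : Ag) (A B : form Ag).

Definition valid A := forall m h, H m h -> sat m h A.

Lemma cell_refl m j h : H m h -> cell m j h h.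
Proof.
have [covH _ _] := Choice_partition (jstit_ofP M) m j.
by rewrite -covH => -[C jC Ch]; exists C.
Qed.

Lemma cell_H m j h g : cell m j h g -> H m g.
Proof.
have [covH _ _] := Choice_partition (jstit_ofP M) m j.
by move=> [C [jC _ Cg]]; rewrite -covH; exists C.
Qed.

Lemma cell_sym m j h g : cell m j h g -> cell m j g h.
Proof. by move=> [C [jC Ch Cg]]; exists C. Qed.

(** Cells of a partition that share [h] coincide; this is what makes the relation [cell]
    transitive. *)
Lemma choice_cell m j (C : set (set (Tree M))) h g :
  Choice m j C -> C h -> cell m j h g -> C g.
Proof.
move=> jC Ch [D [jD Dh Dg]].
have [_ triv _] := Choice_partition (jstit_ofP M) m j.
by rewrite (triv C D jC jD) //; exists h.
Qed.

Lemma cell_trans m j h g k : cell m j h g -> cell m j g k -> cell m j h k.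
Proof.
by move=> [C [jC Ch Cg]] /(choice_cell jC Cg) Ck; exists C.
Qed.

(** * S4 and S5 for a modality given by accessibility between moment-history pairs *)

Section Modality.
Variables (Mod : form Ag -> form Ag).
Variable acc : Tree M -> set (Tree M) -> Tree M -> set (Tree M) -> Prop.
Hypothesis satMod : forall m h A,
  sat m h (Mod A) <-> forall m' h', acc m h m' h' -> sat m' h' A.
Hypothesis acc_refl : forall m h, H m h -> acc m h m h.
Hypothesis acc_trans : forall m h m' h' m'' h'',
  acc m h m' h' -> acc m' h' m'' h'' -> acc m h m'' h''.

Lemma S4_valid A : S4_axiom Mod A -> valid A.
Proof.
case=> [B C|B|B] m h Hmh; apply/sat_Imp.
- move=> /satMod hBC; apply/sat_Imp => /satMod hB; apply/satMod => m' h' mm'.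
  by have /sat_Imp := hBC _ _ mm'; apply; exact: hB.
- by move=> /satMod; apply; exact: acc_refl.
- move=> /satMod hB; apply/satMod => m' h' mm'; apply/satMod => m'' h'' mm''.
  exact: hB (acc_trans mm' mm'').
Qed.

(** Assumed only after [S4_valid], which thus also applies to [Know], whose relation need not be
    symmetric. The relation used for [Box] is symmetric only at pairs with [H m h]. *)
Hypothesis acc_sym : forall m h m' h', H m h -> acc m h m' h' -> acc m' h' m h.

Lemma S5_valid A : S5_axiom Mod A -> valid A.
Proof.
case=> [{}A /S4_valid //|B|B] m h Hmh; apply/sat_Imp => hB;
  apply/satMod => m' h' mm' /satMod hB'.
- exact: hB' (acc_sym Hmh mm') hB.
(* Axiom 5: by symmetry and transitivity, whatever is accessible from [(m, h)] is accessible from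
   [(m', h')]. *)
- apply: hB; apply/satMod => m'' h'' mm''; apply: hB'.
  exact: acc_trans (acc_sym Hmh mm') mm''.
Qed.

End Modality.

Lemma Box_S5_valid A : S5_axiom (@Box Ag) A -> valid A.
Proof.
apply: (@S5_valid _ (fun m h m' h' => m' = m /\ H m h')) => [m h B|||].
- by split=> [hB m' h' [-> /hB]|hB h' Hh'] //; exact: hB.
- by [].
- by move=> m h m' h' m'' h'' [-> _] [-> ?].
- by move=> m h m' h' Hh [-> _].
Qed.

Lemma Stit_S5_valid j A : S5_axiom (@Stit Ag j) A -> valid A.
Proof.
apply: (@S5_valid _ (fun m h m' h' => m' = m /\ cell m j h h')) => [m h B|||].
- by split=> [hB m' h' [-> /hB]|hB h' Hh'] //; exact: hB.
- by move=> m h /(cell_refl j).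
- by move=> m h m' h' m'' h'' [-> hh'] [-> /(cell_trans hh')].
- by move=> m h m' h' _ [-> /cell_sym].
Qed.

Lemma R_refl m : R m m.
Proof. by have [refl _] := R_preorder (jstit_ofP M); exact: refl. Qed.

Lemma R_trans m m' m'' : R m m' -> R m' m'' -> R m m''.
Proof. by have [_ trans] := R_preorder (jstit_ofP M); exact: trans. Qed.

Lemma Re_refl m : Re m m.
Proof. by have [refl _] := Re_preorder (jstit_ofP M); exact: refl. Qed.

Lemma Re_trans m m' m'' : Re m m' -> Re m' m'' -> Re m m''.
Proof. by have [_ trans] := Re_preorder (jstit_ofP M); exact: trans. Qed.

Lemma Know_S4_valid A : S4_axiom (@Know Ag) A -> valid A.
Proof.
apply: (@S4_valid _ (fun m h m' h' => R m m' /\ H m' h')) => [m h B||].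
- by split=> [hB m' h' [mm' Hh']|hB m' h' mm' Hh']; exact: hB.
- by move=> m h Hh; split=> //; exact: R_refl.
- by move=> m h m' h' m'' h'' [mm' _] [/(R_trans mm')].
Qed.

(** * Independence of agents *)

Lemma uniq_unzip1_inj (s : seq (Ag * form Ag)) j A B :
  uniq (unzip1 s) -> (j, A) \in s -> (j, B) \in s -> A = B.
Proof.
move=> us sA sB; apply: contrapT => /eqP neqAB.
(* As no agent repeats, a pair and its agent have the same index; two pairs with the same agent
   therefore sit at the same place of [s]. *)
have idx C : (j, C) \in s -> index (j, C) s = index j (unzip1 s).
  move=> sC; rewrite -{2}[j]/((j, C).1) -{2}(nth_index (j, C) sC).
  by rewrite -(nth_map _ j) ?index_mem // index_uniq ?size_map ?index_mem.
have := nth_index (j, A) sB; rewrite (idx _ sB) -(idx _ sA) nth_index //.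
by case=> eqAB; rewrite eqAB eqxx in neqAB.
Qed.

(** Each agent of the list selects the cell of a history witnessing its diamond; independence yields
    a history in all selected cells, where every stit formula holds. *)
Lemma independence_valid (s : seq (Ag * form Ag)) :
  s <> [::] -> uniq (unzip1 s) ->
  valid (bigAnd [seq Diamond (Stit x.1 x.2) | x <- s]
         :->: Diamond (bigAnd [seq Stit x.1 x.2 | x <- s])).
Proof.
move=> s0 us m h Hh; apply/sat_Imp => /sat_bigAnd hs.
have /choice[f fP] j : exists C, Choice m j C /\
    forall g A, C g -> (j, A) \in s -> sat m g (Stit j A).
  have [[A sA]|noA] := pselect (exists A, (j, A) \in s); last first.
    (* An agent outside [s] is unconstrained; the cell of [h] serves as default. *)
    have [C [jC _ _]] := cell_refl j Hh; exists C; split=> // g A _ sA.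
    by case: noA; exists A.
  have /sat_Diamond[g Hg gA] : sat m h (Diamond (Stit j A)).
    by apply: hs; exact: map_f sA.
  have [C [jC Cg _]] := cell_refl j Hg; exists C; split=> // k B Ck sB k' kk'.
  rewrite -(uniq_unzip1_inj us sA sB); apply: gA.
  by exists C; split=> //; exact: choice_cell jC Ck kk'.
have [//|g fg] := @independence_of_agents _ _ (jstit_ofP M) m f.
  by move=> j; have [] := fP j.
have Hg : H m g.
  (* That [g] passes through [m] follows from its lying in a cell at [m]; the first agent of the
     nonempty list supplies one, whereas for empty [Ag] the intersection would say nothing about
     [g]. *)
  case: s s0 {us hs fP} (fun j => (fP j).1) => // -[j _] s _ jf.
  by apply: (@cell_H m j g); exists (f j); split=> //; exact: fg.
apply/sat_Diamond; exists g => //; apply/sat_bigAnd => _ /mapP[[j A] sA ->].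
by apply: (fP j).2 => //; exact: fg.
Qed.

Lemma sat_noProver m h t A :
  sat m h (noProver t A) <-> forall j, ~ sat m h (Prove j t A).
Proof.
rewrite sat_bigAnd; split=> [hA j|hA _ /mapP[j _ ->]]; last exact: hA.
by apply: (hA (:~ Prove j t A)); apply: map_f; rewrite mem_enum.
Qed.

Lemma axiom_valid A : axiom A -> valid A.
Proof.
have Pj := jstit_ofP M.
case=> {A}.
- by move=> A taut m h _; apply/sat_prop_eval; exact: taut.
- exact: Box_S5_valid.
- exact: Stit_S5_valid.
- by move=> j A m h _; apply/sat_Imp => hA h' /cell_H /hA.
- exact: independence_valid.
- move=> s t A B m h _; apply/sat_Imp => -[sAB hAB].
  apply/sat_Imp => -[tA hA]; split; first exact: Evid_app Pj _ _ _ _ _ sAB tA.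
  move=> m' h' mm' Hh'; have /sat_Imp := hAB _ _ mm' Hh'; apply.
  exact: hA.
- move=> t A m h _; apply/sat_Imp => -[tA hA]; split; last first.
    by move=> m' h' mm' Hh'; apply: hA => //; exact: R_sub_Re.
  split=> [|m' h' mm' _]; first exact: Evid_bang.
  split=> [|m'' h'' mm'']; first exact: Evid_mono Pj _ _ _ mm' _ tA.
  exact: hA (Re_trans mm' mm'').
- move=> s t A m h _; apply/sat_Imp => /sat_Or[] [tA hA]; split=> //;
    apply: (Evid_sum Pj); [by left | by right].
- exact: Know_S4_valid.
(* A8: [R] relates moments only, so the choice of history is immaterial on both sides. *)
- move=> A m h _; apply/sat_Imp => hA h' _ m' h'' mm' _ g; exact: hA.
- move=> j t A m h Hh; apply/sat_Imp => -[jt tA nt].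
  split; first by case.
  split.
    move=> g hg; split=> // k gk; apply: jt; exact: cell_trans hg gk.
  (* If the proving were settled at [m], then [t] would be in [Act m g] for every [g], each history
     being in its own cell. *)
  split=> // bP; apply: nt => g Hg.
  by have [gt _ _] := bP g Hg; apply: gt; exact: cell_refl.
- by move=> j t A B m h _; apply/sat_Imp => -[[jt _ nt] tB].
- move=> t A m h _; apply/sat_Imp => -[mt [tA hA]]; split=> //.
  move=> m' h' /(R_sub_Re Pj) mm' _; split.
    exact: proofs_transparent Pj _ _ mm' _ mt.
  split=> [|m'' h'' mm'']; first exact: Evid_mono Pj _ _ _ mm' _ tA.
  exact: hA (Re_trans mm' mm'').
- by move=> t A B m h _; apply/sat_Imp => -[[mt _] tB].
move=> j t A m h Hh; apply/sat_Imp => nP; apply/sat_DStit.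
(* B13: if [t] is presented throughout the cell of [j], any prover at [(m, h)] would make [j] one as
   well, so [h] is the witness. Otherwise some [g] in the cell lacks [t], and nobody proves [t]
   there. *)
have [jt|njt] := pselect (Act_mhj m h j t).
  exists h; first exact: cell_refl.
  by apply/sat_noProver => i [_ tA nt]; apply: nP.
move/existsNP: njt => [g /not_implyP[hg ngt]]; exists g => //.
apply/sat_noProver => i [it _ _]; apply: ngt; apply: it.
exact: cell_refl (cell_H hg).
Qed.

(** * Histories through a moment, and the rule (S4) *)

Lemma last_moment_history m h g : H m h -> H m g ->
  (forall m', h m' -> ~ lt m m') -> g = h.
Proof.
move=> [[chh maxh] hm] [[chg maxg] gm] lastm; apply: maxh => // x hx.
have [refl trans _] := le_order (jstit_ofP M).
have le_xm : le x m.
  have [//|le_mx] := chh _ _ hx hm.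
  have [<-|neq] := pselect (m = x); first exact: refl.
  by case: (lastm x hx); split.
(* By maximality of [g] it suffices that adding [x] keeps it a chain: members of [g] below [m] are
   comparable with [x] as there is no backward branching, and those above [m] are above [x]. *)
have ->// : g = g `|` [set x]; last by right.
apply/esym/maxg; last by move=> y; left.
have cmp y : g y -> le x y \/ le y x.
  move=> gy; have [le_ym|le_my] := chg _ _ gy gm.
    exact: no_backward_branching (jstit_ofP M) _ _ _ le_xm le_ym.
  by left; exact: trans le_xm le_my.
move=> y z [gy|->] [gz|->]; first exact: chg.
- by have [] := cmp y gy; [right | left].
- exact: cmp.
- by left; exact: refl.
Qed.

Lemma later_moment m h t : H m h -> Act m h t -> ~ Act_m m t ->
  exists2 m', h m' & lt m m'.
Proof.
move=> Hh ht nt; apply: contrapT => noS; apply: nt => g Hg.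
rewrite (last_moment_history Hh Hg) // => m' hm' mm'.
by apply: noS; exists m'.
Qed.

(** A history through [m'] is undivided from [h] at [m], so it presents the same proofs at [m], and
    these are kept up to [m']. *)
Lemma Act_later m m' h t : H m h -> lt m m' -> h m' -> Act m h t -> Act_m m' t.
Proof.
move=> [hist hm] mm' hm' ht g Hg; have Pj := jstit_ofP M.
apply: (Act_expansion Pj mm' Hg).
by rewrite -(@presenting_a_new_proof _ _ Pj m h g) //; exists m'.
Qed.

Lemma S4_rule_valid A (s : seq (pol * form Ag)) : s <> [::] ->
  valid (Know A :->: bigOr [seq :~ Proven x.1 x.2 | x <- s]) ->
  valid (Know A :->: bigOr [seq noProver x.1 x.2 | x <- s]).
Proof.
move=> s0 vA m h Hh; apply/sat_Imp => KA; apply: contrapT => nP.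
have provers x : x \in s -> exists j, sat m h (Prove j x.1 x.2).
  move=> sx; apply: contrapT => nex; apply: nP; apply/sat_bigOr.
  exists (noProver x.1 x.2); first exact: (map_f (fun x => noProver x.1 x.2)).
  by apply/sat_noProver => j jx; apply: nex; exists j.
have Acth x : x \in s -> Act m h x.1.
  by move=> /provers[j [jx _ _]]; apply: jx; exact: cell_refl.
(* The first pair of the nonempty list provides [m']; any strictly later moment on [h] then serves
   all pairs at once. *)
have [m' hm' mm'] : exists2 m', h m' & lt m m'.
  case: s s0 provers Acth {vA nP} => // x s _ provers Acth.
  have xs : x \in x :: s by rewrite inE eqxx.
  by have [j [_ _]] := provers x xs; exact: later_moment (Acth x xs).
have Rmm' : R m m' by exact: future_matters (jstit_ofP M) _ _ mm'.1.
have /sat_Imp : sat m' h (Know A :->: bigOr [seq :~ Proven x.1 x.2 | x <- s]).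
  by apply: vA; case: Hh.
have KA' : sat m' h (Know A).
  by move=> m'' h'' /(R_trans Rmm'); exact: KA.
move=> /(_ KA') /sat_bigOr[_ /mapP[x sx ->]]; apply.
have [j [_ [xA hA] _]] := provers x sx.
split; first exact: Act_later (Acth x sx).
have Remm' := R_sub_Re (jstit_ofP M) Rmm'.
split=> [|m'' h'' mm''].
  exact: Evid_mono (jstit_ofP M) _ _ _ Remm' _ xA.
exact: hA (Re_trans Remm' mm'').
Qed.

(** * Constant specifications and the induction on derivations *)

Lemma CS_valid (CS : set (form Ag)) F :
  constant_specification CS -> CS_normal CS M -> CS F -> valid F.
Proof.
move=> hCS nCS /[dup] /(cs_shape hCS)[c [cs [A [axA ->]]]].
(* Normality gives the evidence for the outermost constant; closure of [CS] keeps the inner formula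
   in [CS], so its validity comes from the induction, which ends at an axiom. *)
elim: cs c => [|c' cs IH] c CSF m h _; split=> [|m' h' _ Hh'].
- exact: nCS.
- exact: axiom_valid.
- exact: nCS.
- by apply: (IH c') => //; exact: cs_closed hCS _ _ _ _ axA CSF.
Qed.

End Validity.

Theorem theorem1 (Ag : finType) (CS : set (form Ag)) (A : form Ag)
  (hCS : constant_specification CS) (hA : provable CS A) :
  forall M : jstit_model Ag, CS_normal CS M ->
  forall (m : Tree M) (h : set (Tree M)), MH (m, h) -> sat m h A.
Proof.
(* With the model fixed but the point left universal, the induction hypotheses can be used at other
   moments, as necessitation and (S4) require. *)
move=> M nCS; change (valid M A).
elim: hA => {A} [A|A|A B _ vAB _ vA|A _ vA|A s s0 _].
- exact: axiom_valid.
- exact: CS_valid.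
- by move=> m h Hh; have /sat_Imp := vAB m h Hh; apply; exact: vA.
- by move=> m h _ m' h' _; exact: vA.
- exact: S4_rule_valid.
Qed.
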